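(* With the addition $+$ and multiplication $\times$ on infinite decimals defined in the context, $(\mathbb{R},+,\times)$ is a field.
   Context: Here $\mathbb{R}$ is NOT a previously constructed real field but the set of infinite decimals $$\mathbb{R}=\{a_0.a_1a_2a_3\cdots\in\mathbb{Z}\times\mathbb{Z}_{10}^{\mathbb{N}}: a_k<9\ \text{for infinitely many}\ k\},$$ where $\mathbb{Z}_{10}=\{0,1,\dots,9\}$ (as a set) and $\mathbb{N}=\{1,2,3,\dots\}$. An element $x=a_0.a_1a_2\cdots$ is terminating if there is a non-negative integer $m$ with $a_k=0$ for all $k>m$; it is then written $a_0.a_1\cdots a_m$ and identified with the rational number $a_0+\sum_{i=1}^m a_i10^{-i}$ (the integer part $a_0$ may be negative while the digits $a_i$, $i\ge 1$, are always in $\{0,\dots,9\}$, e.g. $(-8).765=-8+0.765$). Arithmetic on terminating decimals is the usual one under this identification. In particular $0$, $1$, $10^{s}$, $10^{-m}$ are elements of $\mathbb{R}$. For $x=a_0.a_1a_2\cdots\in\mathbb{R}$ and a non-negative integer $k$, let $\theta_k(x)=a_k$ and let $x_k=a_0.a_1\cdots a_k$ be the truncation of $x$ (a terminating decimal). The element $x$ is non-negative if $a_0\ge 0$ and negative if $a_0<0$. The order is the dictionary (lexicographic) order on $\mathbb{Z}\times\mathbb{Z}_{10}^{\mathbb{N}}$, and $x\le y$ means $x<y$ or $x=y$. Addition. Let $x,y\in\mathbb{R}$. Case 1: if there is a non-negative integer $m$ such that $\theta_k(x_k+y_k)=9$ for all $k>m$, then $x+y=(x_m+y_m)_m+10^{-m}$.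 Case 2: if there is a sequence of positive integers $k_1<k_2<\cdots$ such that $\theta_{k_i}(x_{k_i}+y_{k_i})\neq 9$ for all $i\in\mathbb{N}$, then $x+y$ is defined by $(x+y)_{k_i-1}=(x_{k_i}+y_{k_i})_{k_i-1}$ for all $i\in\mathbb{N}$. Subtraction. Let $x,y\in\mathbb{R}$. Case 1: if there is a non-negative integer $m$ such that $\theta_k(x_k)=\theta_k(y_k)$ for all $k>m$, then $x-y=x_m-y_m$. Case 2: if there is a sequence of positive integers $k_1<k_2<\cdots$ such that $\theta_{k_i}(x_{k_i})\ne\theta_{k_i}(y_{k_i})$ for all $i\in\mathbb{N}$, then $x-y$ is defined by $(x-y)_{k_i-1}=(x_{k_i}-y_{k_i})_{k_i-1}$ for all $i\in\mathbb{N}$. Write $-x$ for $0-x$. Multiplication. Let $x,y\in\mathbb{R}$; $xy$ and $x\times y$ denote the same product. (1) Suppose $x,y$ are non-negative. Fix a non-negative integer $s$ such that $x+y\le 10^{s}$. Case 1: if there is a non-negative integer $m$ such that $\theta_k(x_{k+s}y_{k+s})=9$ for all $k>m$, then $xy=(x_{m+s}y_{m+s})_m+10^{-m}$. Case 2: if there is a sequence of positive integers $k_1<k_2<\cdots$ such that $\theta_{k_i}(x_{k_i+s}y_{k_i+s})\ne 9$ for all $i\in\mathbb{N}$, then $xy$ is defined by $(xy)_{k_i-1}=(x_{k_i+s}y_{k_i+s})_{k_i-1}$ for all $i\in\mathbb{N}$. (2) If $x,y$ are both negative, $xy=(-x)(-y)$. (3) If exactly one of $x,y$ is negative, $xy=-(x(-y))$.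 (If $x$ is the negative one, both $x$ and $-y$ may be negative or $-y$ may be $0$; in that case the product is understood by symmetry as $-((-x)y)$.) These operations do not depend on the auxiliary choices of $m$, $s$ and $(k_i)$. *)

(* Defs.v *)
From HB Require Import structures.
From mathcomp Require Import all_boot all_order all_algebra.
From mathcomp Require Import boolp classical_sets.

Set Implicit Arguments.
Unset Strict Implicit.
Unset Printing Implicit Defensive.

Import Order.TTheory GRing.Theory Num.Theory.
Local Open Scope ring_scope.

(* Fractional digits are indexed from 0: [digit x i] is the digit a_(i+1) of
   x = a_0.a_1a_2a_3... *)
Record decimal : Type := Decimal {
  ipart : int;
  digit : nat -> 'I_10;
  digit_lt9 : forall n : nat, exists2 i : nat, (n <= i)%N & (digit i < 9)%N
}.

HB.instance Definition _ := gen_eqMixin decimal.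
HB.instance Definition _ := gen_choiceMixin decimal.

Definition theta (k : nat) (x : decimal) : int :=
  if k is j.+1 then (digit x j : nat)%:Z else ipart x.

Definition dlt (x y : decimal) : Prop :=
  exists k : nat,
    (forall j : nat, (j < k)%N -> theta j x = theta j y) /\
    theta k x < theta k y.

Definition dle (x y : decimal) : Prop := dlt x y \/ x = y.

(* The truncation x_k = a_0.a_1...a_k, as the rational number with which this
   terminating decimal is identified. *)
Definition truncation (x : decimal) (k : nat) : rat :=
  (ipart x)%:~R + \sum_(1 <= i < k.+1) (theta i x)%:~R * 10 ^- i.

Definition terminating_value (x : decimal) (q : rat) : Prop :=
  exists m : nat,
    (forall k : nat, (m < k)%N -> theta k x = 0) /\ q = truncation x m.

Lemma zero_digit_lt9 (n : nat) :
  exists2 i : nat, (n <= i)%N & ((fun _ : nat => ord0 : 'I_10) i < 9)%N.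
Proof. by exists n. Qed.

Definition dzero : decimal := Decimal 0 zero_digit_lt9.

(* The inverse of the identification: the terminating decimal with value [q].
   The default [dzero] of [xget] is reached only when [q] is not of the form
   n / 10 ^ m, and this never happens below. *)
Definition tdec (q : rat) : decimal :=
  xget dzero [set x | terminating_value x q].

Definition increasing_positive (k : nat -> nat) : Prop :=
  (0 < k 0)%N /\ forall i : nat, (k i < k i.+1)%N.

(* In each specification below, [z] is a value that the definition of the
   operation assigns to [x] and [y], for some choice of the auxiliary m, s and
   (k_i). *)

Definition add_spec (x y z : decimal) : Prop :=
  let w k := tdec (truncation x k + truncation y k) in
  (exists m : nat,
     (forall k : nat, (m < k)%N -> theta k (w k) = 9) /\
     z = tdec (truncation (w m) m + 10 ^- m)) \/
  (exists k : nat -> nat,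
     [/\ increasing_positive k,
         forall i : nat, theta (k i) (w (k i)) <> 9 &
         forall i : nat,
           truncation z (k i).-1 = truncation (w (k i)) (k i).-1]).

Definition dadd (x y : decimal) : decimal :=
  xget dzero [set z | add_spec x y z].

Definition sub_spec (x y z : decimal) : Prop :=
  let t u k := theta k (tdec (truncation u k)) in
  (exists m : nat,
     (forall k : nat, (m < k)%N -> t x k = t y k) /\
     z = tdec (truncation x m - truncation y m)) \/
  (exists k : nat -> nat,
     [/\ increasing_positive k,
         forall i : nat, t x (k i) <> t y (k i) &
         forall i : nat,
           truncation z (k i).-1 =
           truncation (tdec (truncation x (k i) - truncation y (k i)))
             (k i).-1]).

Definition dsub (x y : decimal) : decimal :=
  xget dzero [set z | sub_spec x y z].

Definition dopp (x : decimal) : decimal := dsub dzero x.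

Definition nonneg_mul_spec (x y z : decimal) : Prop :=
  exists s : nat,
    dle (dadd x y) (tdec (10 ^+ s)) /\
    let w k := tdec (truncation x (k + s)%N * truncation y (k + s)%N) in
    ((exists m : nat,
        (forall k : nat, (m < k)%N -> theta k (w k) = 9) /\
        z = tdec (truncation (w m) m + 10 ^- m)) \/
     (exists k : nat -> nat,
        [/\ increasing_positive k,
            forall i : nat, theta (k i) (w (k i)) <> 9 &
            forall i : nat,
              truncation z (k i).-1 = truncation (w (k i)) (k i).-1])).

Definition nonneg_mul (x y : decimal) : decimal :=
  xget dzero [set z | nonneg_mul_spec x y z].

(* If only [x] is negative, the product is read as - ((- x) y). The opposite of
   a negative decimal is positive, so [nonneg_mul] always applies. *)
Definition dmul (x y : decimal) : decimal :=
  match 0 <= ipart x, 0 <= ipart y with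
  | true, true => nonneg_mul x y
  | false, false => nonneg_mul (dopp x) (dopp y)
  | true, false => dopp (nonneg_mul x (dopp y))
  | false, true => dopp (nonneg_mul (dopp x) y)
  end.

(* There is a field structure whose carrier is [T] itself and whose addition
   and multiplication are [add] and [mul]. *)
Definition is_field (T : Type) (add mul : T -> T -> T) : Prop :=
  exists c : GRing.Field.axioms_ T,
    let F : fieldType := GRing.Field.Pack c in
    (forall x y : F, x + y = add x y) /\
    (forall x y : F, x * y = mul x y).

(* Main.v *)
Require Import Defs.
From HB Require Import structures.
From mathcomp Require Import all_boot all_order all_algebra.
From mathcomp Require Import boolp classical_sets reals Rstruct.
From mathcomp Require Import zify ring lra.

Set Implicit Arguments.
Unset Strict Implicit.
Unset Printing Implicit Defensive.

Import Order.TTheory GRing.Theory Num.Theory.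
Local Open Scope ring_scope.

(** Every infinite decimal [x] has a value in a complete ordered field [R],
    namely the supremum of its truncations x_k. This gives a bijection from the
    decimals to [R] that carries [dadd] and [dmul] to the addition and the
    multiplication of [R], so the field axioms are pulled back from [R].

    The bijection rests on the inequalities
    10^k x_k <= 10^k x < 10^k x_k + 1 ([value_bounds]), where the strict one
    uses that infinitely many digits differ from 9. They say that the integer
    10^k x_k, called [mantissa x k], is the floor of 10^k x; hence the value
    determines the digits ([value_inj]), and the digits of the successive floors
    of 10^k r give a decimal with value r ([decimal_ofK]).

    Addition of any decimals and multiplication of nonnegative ones follow the
    same rule ([carry_spec]), applied to terminating approximations w_k of the
    result r. Let C_k be the floor of 10^k w_k. In both cases
    C_k <= 10^k r < C_k + 2 and 10 C_k <= C_(k+1), so the floor of 10^k r is C_k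
    or C_k + 1. If the last digit of C_k is not 9,
    then both candidates agree up to the decimal k - 1, which is what the rule
    copies. If the last digit of C_k is 9 for all k > m, then
    C_k + 1 = 10^(k-m) (C_m + 1), as otherwise r itself would end in 9's; hence
    r = (C_m + 1) / 10^m, as the rule says. This is [carry_spec_value].
    Subtraction is treated in the same way with errors in ]-1, 1[ and the last
    digit 0 in place of 9 ([sub_specE]). *)

(** * Truncations as integers *)

(** The integer 10^k x_k, that is, a_0 a_1 ... a_k read without the decimal
    point. *)
Fixpoint mantissa (x : decimal) (k : nat) : int :=
  if k is j.+1 then 10 * mantissa x j + theta j.+1 x else ipart x.

Lemma thetaS_bounds x k : 0 <= theta k.+1 x <= 9.
Proof. by rewrite /theta; have := ltn_ord (digit x k); lia. Qed.

Lemma truncationE x k : truncation x k = (mantissa x k)%:~R / 10 ^+ k.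
Proof.
elim: k => [|k IHk].
  by rewrite /truncation big_geq // expr0 addr0 divr1.
rewrite /truncation big_nat_recr //= addrA -/(truncation x k) IHk.
rewrite rmorphD rmorphM /= exprS.
by field; rewrite expf_neq0.
Qed.

Lemma truncationP x y k : truncation x k = truncation y k <-> mantissa x k = mantissa y k.
Proof.
rewrite !truncationE; split=> [|-> //].
have u : (10 ^+ k : rat)^-1 != 0 by rewrite invr_eq0 expf_neq0.
by move/(mulIf u)/intr_inj.
Qed.

Lemma mantissaS x k : mantissa x k.+1 = 10 * mantissa x k + theta k.+1 x.
Proof. by []. Qed.

Lemma thetaS x k : theta k.+1 x = mantissa x k.+1 - 10 * mantissa x k.
Proof. by rewrite mantissaS addrC addKr. Qed.

Lemma mantissa_inj x y : mantissa x =1 mantissa y -> x = y.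
Proof.
move=> e; have /= e0 := e 0.
have ed : digit x = digit y.
  apply: funext => k; apply: val_inj => /=.
  have := thetaS x k; have := thetaS y k; rewrite !e => <- /=.
  by case.
case: x y e0 ed {e} => [a f hf] [b g hg] /= ea ef; subst b g.
by rewrite (Prop_irrelevance hf hg).
Qed.

Lemma mantissa_add_ge x k n : mantissa x k * 10 ^+ n <= mantissa x (k + n).
Proof.
elim: n => [|n IHn]; first by rewrite addn0 mulr1.
by rewrite addnS exprS; have := thetaS_bounds x (k + n); have := thetaS x (k + n); lia.
Qed.

Lemma mantissa_add_lt x k n : mantissa x (k + n) < (mantissa x k + 1) * 10 ^+ n.
Proof.
elim: n => [|n IHn]; first by rewrite addn0 mulr1; lia.
by rewrite addnS exprS; have := thetaS_bounds x (k + n); have := thetaS x (k + n); lia.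
Qed.

(** The bound of [mantissa_add_lt] cannot remain tight: a digit below 9 occurs
    after the k-th one. *)
Lemma mantissa_add_lt9 x k : exists n, mantissa x (k + n) + 1 < (mantissa x k + 1) * 10 ^+ n.
Proof.
have [i ki xi] := digit_lt9 x k.
exists (i - k).+1; rewrite addnS subnKC //.
have := mantissa_add_lt x k (i - k); rewrite subnKC // exprS.
have := thetaS x i; rewrite [theta _ _]/=.
by rewrite mulrCA; lia.
Qed.

Lemma mantissa_pred x y k :
  mantissa x k.+1 = mantissa y k.+1 -> mantissa x k = mantissa y k.
Proof.
by rewrite !mantissaS; have := thetaS_bounds x k; have := thetaS_bounds y k; lia.
Qed.

Lemma not_eventually_theta9 z n : (forall k, (n < k)%N -> theta k z = 9) -> False.
Proof.
by move=> h; have [i ni] := digit_lt9 z n; have := h i.+1 ni => /=; lia.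
Qed.

(** * Subsequences *)

Lemma subsequenceP (P : nat -> Prop) :
  (forall m, exists2 k, (m < k)%N & P k) ->
  exists k, increasing_positive k /\ forall i, P (k i).
Proof.
move=> h; have [f lt_f Pf] := all_sig2 (fun m => cid2 (h m)).
exists (fun i => iter i f (f 0%N)); split; last by case=> [|i] /=; apply: Pf.
by split=> [|i]; [exact: lt_f | rewrite iterS; exact: lt_f].
Qed.

Lemma increasing_positive_gt k : increasing_positive k -> forall i, (i < k i)%N.
Proof.
by case=> k0 lt_k; elim=> // i IHi; exact: leq_ltn_trans IHi (lt_k i).
Qed.

(** * Values of decimals *)

Lemma int_rangeP (R : numDomainType) (a b : int) (r : R) :
  a%:~R <= r < a%:~R + 1 -> b%:~R <= r < b%:~R + 1 -> a = b.
Proof.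
move=> /andP[h1 h2] /andP[h3 h4].
have := le_lt_trans h1 h4; have := le_lt_trans h3 h2.
by rewrite -!(intrD _ _ 1) !ltr_int; lia.
Qed.

Lemma intr_pow10 (R : pzRingType) k : 10 ^+ k = (10 ^+ k)%:~R :> R.
Proof. by rewrite rmorphXn. Qed.

Section Value.
Variable R : realType.
Implicit Types (r : R) (x y z : decimal).

Lemma pow10_gt0 k : 0 < 10 ^+ k :> R. Proof. by rewrite exprn_gt0. Qed.

Lemma pow10_neq0 k : 10 ^+ k != 0 :> R. Proof. exact: lt0r_neq0 (pow10_gt0 k). Qed.

Lemma pow10_unbounded r : exists n, r < 10 ^+ n.
Proof.
have nat_lt n : n%:R < 10 ^+ n :> R by rewrite -natrX ltr_nat ltn_expl.
exists (Num.bound `|r|); apply: le_lt_trans (nat_lt _).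
by rewrite (le_trans (ler_norm r)) // ltW ?archi_boundP.
Qed.

(** Numbers whose distance is O(10^-n) along infinitely many n are equal. *)
Lemma eq_pow10_close r1 r2 c :
  (forall k, exists2 n, (k <= n)%N & 10 ^+ n * `|r1 - r2| <= c) -> r1 = r2.
Proof.
move=> h; apply/eqP; rewrite -subr_eq0 -normr_le0 leNgt; apply/negP => d_gt0.
have [k lt_k] := pow10_unbounded (c / `|r1 - r2|); have [n kn] := h k.
apply/negP; rewrite -ltNge -ltr_pdivrMr // (lt_le_trans lt_k) //.
by rewrite ler_eXn2l // ltr1n.
Qed.

(** The real number that [x] denotes: the supremum of its truncations. *)
Definition value x : R := sup (range (fun k => (mantissa x k)%:~R / 10 ^+ k)).

Let upper x k n : (mantissa x n)%:~R / 10 ^+ n <= (mantissa x k + 1)%:~R / 10 ^+ k :> R.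
Proof.
rewrite ler_pdivrMr ?pow10_gt0 // mulrAC ler_pdivlMr ?pow10_gt0 //.
rewrite (intr_pow10 R k) (intr_pow10 R n) -!rmorphM ler_int.
have [nk|/ltnW kn] := leqP n k.
  have := mantissa_add_ge x n (k - n); have := mantissa_add_lt x n (k - n).
  rewrite subnKC //; have -> : 10 ^+ k = 10 ^+ n * 10 ^+ (k - n) :> int.
    by rewrite -exprD subnKC.
  by move=> _ ?; rewrite mulrCA [leLHS]mulrC ler_pM2r ?exprn_gt0 //; lia.
have := mantissa_add_lt x k (n - k); rewrite subnKC //.
have -> : 10 ^+ n = 10 ^+ k * 10 ^+ (n - k) :> int by rewrite -exprD subnKC.
by move=> ?; rewrite mulrCA [leLHS]mulrC ler_pM2l ?exprn_gt0 //; lia.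
Qed.

Let value_le x k : value x <= (mantissa x k + 1)%:~R / 10 ^+ k.
Proof.
apply: ge_sup; first by exists ((mantissa x 0)%:~R / 10 ^+ 0); exists 0%N.
by move=> _ [n _ <-].
Qed.

Lemma value_bounds x k :
  (mantissa x k)%:~R <= 10 ^+ k * value x < (mantissa x k)%:~R + 1.
Proof.
rewrite mulrC; apply/andP; split.
  rewrite -ler_pdivrMr ?pow10_gt0 //; apply: ub_le_sup; last by exists k.
  by exists ((mantissa x 0 + 1)%:~R / 10 ^+ 0) => _ [n _ <-].
have [n hn] := mantissa_add_lt9 x k.
have := value_le x (k + n); rewrite ler_pdivlMr ?pow10_gt0 //.
rewrite exprD mulrA -(ltr_pM2r (pow10_gt0 n)) => /le_lt_trans; apply.
by rewrite (intr_pow10 R n) -[1]/(1%:~R) -rmorphD -rmorphM ltr_int.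
Qed.

Lemma mantissa_eq x k (n : int) :
  n%:~R <= 10 ^+ k * value x < n%:~R + 1 -> mantissa x k = n.
Proof. exact/int_rangeP/value_bounds. Qed.

Lemma value_inj : injective value.
Proof.
by move=> x y e; apply: mantissa_inj => k; apply: mantissa_eq; rewrite e value_bounds.
Qed.

Lemma value_unique x r :
  (forall k, (mantissa x k)%:~R <= 10 ^+ k * r <= (mantissa x k)%:~R + 1) ->
  value x = r.
Proof.
move=> h; apply: (@eq_pow10_close _ _ 1) => k; exists k => //.
rewrite -[10 ^+ k]ger0_norm ?(ltW (pow10_gt0 k)) // -normrM mulrBr.
by have /andP[] := value_bounds x k; have /andP[] := h k; rewrite ler_norml; lra.
Qed.

(** The digit a_(i+1) of a real number. The difference of floors lies between 0
    and 9, so neither [absz] nor [inord] alters it ([digit_ofE]). *)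
Definition digit_of r (i : nat) : 'I_10 :=
  inord (absz (Num.floor (10 ^+ i.+1 * r) - 10 * Num.floor (10 ^+ i * r))%R).

Lemma digit_ofE r i : (digit_of r i : nat)%:Z =
  Num.floor (10 ^+ i.+1 * r) - 10 * Num.floor (10 ^+ i * r).
Proof.
have /andP[] := floor_itv (10 ^+ i.+1 * r); have /andP[] := floor_itv (10 ^+ i * r).
rewrite /digit_of exprS -mulrA; set f := Num.floor _; set g := Num.floor _; set u := _ * r.
move=> h1 h2 h3 h4.
have : 10 * f < g + 1 by rewrite -(ltr_int R); lra.
have : g < 10 * (f + 1) by rewrite -(ltr_int R); lra.
by move=> ? ?; rewrite inordK; lia.
Qed.

Lemma digit_of_lt9 r n : exists2 i, (n <= i)%N & (digit_of r i < 9)%N.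
Proof.
have [//|h] := EM (exists2 i, (n <= i)%N & (digit_of r i < 9)%N).
(* If all digits of r after the n-th one were 9, then floor (10^k r) + 1 would be
   multiplied by exactly 10 at each step, so that 10^n r would equal
   floor (10^n r) + 1. *)
have d9 i : Num.floor (10 ^+ (n + i).+1 * r) = 10 * Num.floor (10 ^+ (n + i) * r) + 9.
  have := digit_ofE r (n + i); have := ltn_ord (digit_of r (n + i)).
  have : ~ (digit_of r (n + i) < 9)%N by move=> ?; apply: h; exists (n + i)%N; rewrite ?leq_addr.
  by lia.
have e i : Num.floor (10 ^+ (n + i) * r) + 1 = 10 ^+ i * (Num.floor (10 ^+ n * r) + 1).
  by elim: i => [|i IHi]; rewrite ?addn0 ?mul1r // addnS d9 exprS -mulrA -IHi; ring.
have : 10 ^+ n * r = (Num.floor (10 ^+ n * r) + 1)%:~R.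
  apply: (@eq_pow10_close _ _ 1) => k; exists k => //.
  rewrite -[10 ^+ k]ger0_norm ?(ltW (pow10_gt0 k)) // -normrM mulrBr mulrA -exprD.
  have /andP[] := floor_itv (10 ^+ (k + n) * r).
  rewrite [(k + n)%N]addnC e.
  have := congr1 (fun a : int => a%:~R : R) (e k).
  rewrite !rmorphM !rmorphD /= rmorphXn /= ler_norml.
  by set u := _ * r; set v := _%:~R; lra.
by have /andP[_] := floor_itv (10 ^+ n * r); lra.
Qed.

(** The decimal expansion of [r], the inverse of [value]. *)
Definition decimal_of r : decimal := Decimal (Num.floor r) (digit_of_lt9 r).

Lemma decimal_ofK : cancel decimal_of value.
Proof.
move=> r; apply: value_unique => k.
suff -> : mantissa (decimal_of r) k = Num.floor (10 ^+ k * r).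
  by have /andP[-> h] := floor_itv (10 ^+ k * r); rewrite ltW // -[1]/(1%:~R) -rmorphD.
elim: k => [|k IHk]; first by rewrite mul1r.
by rewrite /= IHk digit_ofE; lia.
Qed.

(** * Terminating decimals and the order *)

(** A decimal is identified with the rational n / 10^m exactly when its value is
    n / 10^m. *)
Lemma terminating_value_mantissa x (n : int) m :
  (10 ^+ m * value x = n%:~R) <-> terminating_value x (n%:~R / 10 ^+ m).
Proof.
split=> [e|[j [t0]]].
  have pm : mantissa x m = n by apply: mantissa_eq; rewrite e; lra.
  have pk k : mantissa x (m + k) = n * 10 ^+ k.
    apply: mantissa_eq; rewrite exprD mulrAC e rmorphM /= rmorphXn /=; lra.
  exists m; split; last by rewrite truncationE pm.
  move=> [//|k]; rewrite ltnS => mk; rewrite thetaS -(subnKC mk) -addnS !pk exprS.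
  by ring.
(* Conversely, the digits of x vanish after the j-th one, so its value is x_j. *)
have pj k : mantissa x (j + k) = mantissa x j * 10 ^+ k.
  elim: k => [|k IHk]; first by rewrite addn0 mulr1.
  by rewrite addnS mantissaS IHk t0 ?exprS; [ring|rewrite ltnS leq_addr].
rewrite truncationE => /(congr1 (@ratr R)); rewrite !fmorph_div /= !ratr_int.
rewrite !rmorphXn /= !ratr_nat => e.
apply: (mulfI (_ : (10 ^+ m)^-1 != 0 :> R)); first by rewrite invr_eq0 pow10_neq0.
rewrite mulKf ?pow10_neq0 // mulrC e; apply: value_unique => k.
have [jk|/ltnW kj] := leqP j k.
  rewrite -(subnKC jk) pj exprD rmorphM /= rmorphXn /=.
  suff -> : 10 ^+ j * 10 ^+ (k - j) * ((mantissa x j)%:~R / 10 ^+ j) =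
         (mantissa x j)%:~R * 10 ^+ (k - j) :> R by lra.
  by field; rewrite pow10_neq0.
have := mantissa_add_ge x k (j - k); have := mantissa_add_lt x k (j - k).
rewrite subnKC // -(ltr_int R) -(ler_int R) !rmorphM !rmorphD /= rmorphXn /=.
have -> : 10 ^+ k * ((mantissa x j)%:~R / 10 ^+ j) = (mantissa x j)%:~R / 10 ^+ (j - k) :> R.
  have -> : 10 ^+ j = 10 ^+ k * 10 ^+ (j - k) :> R by rewrite -exprD subnKC.
  by field; rewrite !pow10_neq0.
by rewrite ler_pdivlMr ?ler_pdivrMr ?pow10_gt0 // => /ltW -> ->.
Qed.

Lemma value_tdec (n : int) m : value (tdec (n%:~R / 10 ^+ m)) = n%:~R / 10 ^+ m.
Proof.
have : terminating_value (tdec (n%:~R / 10 ^+ m)) (n%:~R / 10 ^+ m).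
  apply: (@xgetPex _ dzero [set x | terminating_value x _]).
  exists (decimal_of (n%:~R / 10 ^+ m : R)).
  apply/terminating_value_mantissa; rewrite decimal_ofK.
  by field; rewrite pow10_neq0.
by move/terminating_value_mantissa => <-; field; rewrite pow10_neq0.
Qed.

Lemma ipart_ge0 x : (0 <= ipart x) = (0 <= value x).
Proof.
have := value_bounds x 0; rewrite mul1r /= => /andP[h1 h2].
apply/idP/idP => [|h]; first by rewrite -(ler_int R); lra.
suff : 0 < ipart x + 1 by lia.
by rewrite -(ltr_int R) rmorphD /=; lra.
Qed.

Lemma dlt_value x y : dlt x y -> value x < value y.
Proof.
case=> k [ej lt_k].
have p j : (j < k)%N -> mantissa x j = mantissa y j.
  elim: j => [|j IHj] jk; first exact: (ej 0%N).
  by rewrite !mantissaS IHj ?ej // ltnW.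
have : mantissa x k + 1 <= mantissa y k.
  case: k ej lt_k p => [|k] _ lt_k p; first by move: lt_k => /=; lia.
  by rewrite !mantissaS p //; move: lt_k; lia.
rewrite -(ler_int R) rmorphD /= -(ltr_pM2l (pow10_gt0 k)).
by have /andP[] := value_bounds x k; have /andP[] := value_bounds y k; lra.
Qed.

Lemma dle_value x y : dle x y <-> value x <= value y.
Proof.
split=> [[/dlt_value/ltW //|-> //]|le_xy].
have [xy|xy] := EM (x = y); [by right|left].
have h : exists k, theta k x != theta k y.
  apply: contrapT => h; apply: xy; apply: mantissa_inj.
  have t k : theta k x = theta k y by apply/eqP/negPn/negP => ?; apply: h; exists k.
  by elim=> [|k IHk]; [exact: (t 0%N) | rewrite !mantissaS IHk t].
have [k tk k_min] := ex_minnP h.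
have ej j : (j < k)%N -> theta j x = theta j y.
  by move=> jk; apply/eqP/negPn/negP => /k_min; rewrite leqNgt jk.
move: tk; rewrite neq_lt => /orP[lt|lt]; first by exists k.
(* The first digit at which x and y differ decides the order; it cannot be larger
   in x, as this would give y < x. *)
suff /dlt_value : dlt y x by rewrite ltNge le_xy.
by exists k; split=> // j /ej.
Qed.

(** * The carry rule *)

(** The rule by which a decimal [z] is read off a sequence of terminating
    approximations [w k]: it is common to addition and to the multiplication of
    nonnegative decimals. *)
Definition carry_spec (w : nat -> decimal) (z : decimal) : Prop :=
  (exists m : nat,
     (forall k : nat, (m < k)%N -> theta k (w k) = 9) /\
     z = tdec (truncation (w m) m + 10 ^- m)) \/
  (exists k : nat -> nat,
     [/\ increasing_positive k,
         forall i : nat, theta (k i) (w (k i)) <> 9 &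
         forall i : nat,
           truncation z (k i).-1 = truncation (w (k i)) (k i).-1]).

(** In this section C_k is the floor of 10^k w_k, and [z] is the decimal with
    value [r]; the hypotheses say that the truncations C_k / 10^k lie
    below r by less than 2 * 10^-k, and that they do not decrease. *)
Section Carry.
Variables (w : nat -> decimal) (r : R).
Let C k := mantissa (w k) k.
Hypothesis C_le : forall k, (C k)%:~R <= 10 ^+ k * r.
Hypothesis lt_C : forall k, 10 ^+ k * r < (C k)%:~R + 2.
Hypothesis C_mono : forall k, 10 * C k <= C k.+1.

Let z := decimal_of r.

Let C_or k : mantissa z k = C k \/ mantissa z k = C k + 1.
Proof.
have := value_bounds z k; rewrite decimal_ofK => /andP[h1 h2].
have : C k < mantissa z k + 1 by rewrite -(ltr_int R) rmorphD /=; have := C_le k; lra.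
have : mantissa z k < C k + 2 by rewrite -(ltr_int R) rmorphD /=; have := lt_C k; lra.
by lia.
Qed.

(** If the k-th digit of w_k is 9 from some point on, then C_(k+1) = 10 C_k + 9
    from there on. *)
Lemma carry_all9 m : (forall k, (m < k)%N -> theta k (w k) = 9) ->
  forall k, C (m + k) + 1 = (C m + 1) * 10 ^+ k.
Proof.
move=> t9.
have CS n : (m <= n)%N -> C n.+1 = 10 * mantissa (w n.+1) n + 9.
  by move=> mn; rewrite /C mantissaS t9.
(* Once z agrees with w at a place n >= m, its next digit is 9 and it agrees with
   w at the place n + 1. *)
have base n : (m <= n)%N -> mantissa z n = C n -> C n.+1 = 10 * C n + 9 /\ mantissa z n.+1 = C n.+1.
  move=> mn en; have := C_or n.+1; have := C_mono n; have := thetaS z n.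
  by have := thetaS_bounds z n; have := CS n mn; lia.
(* Failure of C_(n+1) = 10 C_n + 9 forces C_(n+1) = 10 C_n + 19, which is so large
   that z agrees with w at the place n + 1. By [base] all later digits of z are
   9, which is excluded. *)
have step n : (m <= n)%N -> C n.+1 = 10 * C n + 9.
  move=> mn; have [//|e] := eqVneq (C n.+1) (10 * C n + 9).
  have en1 : mantissa z n.+1 = C n.+1.
    have := C_or n; have := C_or n.+1; have := C_mono n; have := thetaS z n.
    by have := thetaS_bounds z n; have := CS n mn; lia.
  have all k : mantissa z (n.+1 + k) = C (n.+1 + k).
    elim: k => [|k IHk]; first by rewrite addn0.
    rewrite addnS; apply: (base _ _ IHk).2; lia.
  case: (@not_eventually_theta9 z n.+1) => -[//|k]; rewrite ltnS => nk.
  rewrite thetaS -(subnKC nk) -addnS !all addnS.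
  have [|-> _] := base (n.+1 + (k - n.+1))%N _ (all _); first by lia.
  by ring.
elim=> [|k IHk]; first by rewrite addn0 mulr1.
by rewrite addnS step ?leq_addr // exprS; lia.
Qed.

Lemma carry_spec_value x : carry_spec w x <-> value x = r.
Proof.
have case1 m : (forall k, (m < k)%N -> theta k (w k) = 9) ->
    value (tdec (truncation (w m) m + 10 ^- m)) = r.
  move=> t9; rewrite truncationE -/(C m).
  have -> : (C m)%:~R / 10 ^+ m + 10 ^- m = (C m + 1)%:~R / 10 ^+ m :> rat.
    by rewrite rmorphD /= mulrDl mul1r.
  rewrite value_tdec; apply: (@eq_pow10_close _ _ 1) => k.
  exists (m + k)%N; first exact: leq_addl.
  rewrite -[X in X * `|_|]ger0_norm ?(ltW (pow10_gt0 _)) // -normrM mulrBr.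
  have := congr1 (fun a : int => a%:~R : R) (carry_all9 t9 k).
  rewrite /= rmorphM rmorphXn /= -/(C m).
  have -> : 10 ^+ (m + k) * ((C m + 1)%:~R / 10 ^+ m) = (C m + 1)%:~R * 10 ^+ k :> R.
    by rewrite exprD; field; rewrite pow10_neq0.
  move=> <-; rewrite rmorphD /= ler_norml.
  by have := C_le (m + k); have := lt_C (m + k); lra.
(* Adding 1 to C_k does not change its leading part when its last digit is not 9. *)
have case2 k : (0 < k)%N -> theta k (w k) <> 9 -> mantissa z k.-1 = mantissa (w k) k.-1.
  case: k => // k _ t9 /=; have := C_or k.+1; rewrite [C k.+1]mantissaS.
  have := thetaS_bounds (w k.+1) k; have := thetaS_bounds z k; have := thetaS z k.
  by lia.
split=> [[[m [t9 ->]]|[k [k_inc t9 ex]]]|xr]; first exact: case1.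
  apply: (@eq_pow10_close _ _ 1) => n; exists (k n).-1.
    by have := increasing_positive_gt k_inc n; lia.
  have kn : (0 < k n)%N by have := increasing_positive_gt k_inc n; lia.
  move: (ex n) => /truncationP; rewrite -(case2 _ kn (t9 n)) => e.
  rewrite -[X in X * `|_|]ger0_norm ?(ltW (pow10_gt0 _)) // -normrM mulrBr.
  have := value_bounds x (k n).-1; have := value_bounds z (k n).-1.
  by rewrite decimal_ofK e ler_norml; lra.
have -> : x = z by apply: value_inj; rewrite decimal_ofK.
have [[m t9]|h] := EM (exists m, forall k, (m < k)%N -> theta k (w k) = 9).
  by left; exists m; split=> //; apply: value_inj; rewrite decimal_ofK case1.
right; have [k [k_inc t9]] : exists k, increasing_positive k /\
    forall i, theta (k i) (w (k i)) <> 9.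
  apply: (@subsequenceP (fun k => theta k (w k) <> 9)) => m.
  apply: contrapT => h'; apply: h; exists m => k mk.
  by apply: contrapT => t9; apply: h'; exists k.
exists k; split=> // i; apply/truncationP/case2 => //.
by have := increasing_positive_gt k_inc i; lia.
Qed.

End Carry.

Lemma mantissa_tdec (n : int) m : mantissa (tdec (n%:~R / 10 ^+ m)) m = n.
Proof.
apply: mantissa_eq; rewrite value_tdec mulrC divfK ?pow10_neq0 //; lra.
Qed.

(** * Addition and subtraction *)

(** Here C_k = 10^k x_k + 10^k y_k. *)
Lemma add_specE x y z : add_spec x y z <-> value z = value x + value y.
Proof.
rewrite /add_spec /=; set w := fun k => tdec (truncation x k + truncation y k).
have wE k : mantissa (w k) k = mantissa x k + mantissa y k.
  by rewrite /w !truncationE -mulrDl -rmorphD mantissa_tdec.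
apply: (@carry_spec_value w) => k; rewrite !wE.
- by rewrite rmorphD /=; have := value_bounds x k; have := value_bounds y k; lra.
- by rewrite rmorphD /=; have := value_bounds x k; have := value_bounds y k; lra.
- rewrite !mantissaS; have := thetaS_bounds x k; have := thetaS_bounds y k; lia.
Qed.

Lemma value_dadd x y : value (dadd x y) = value x + value y.
Proof.
apply/add_specE/(@xgetPex _ dzero [set z | add_spec x y z]).
by exists (decimal_of (value x + value y)); apply/add_specE; rewrite decimal_ofK.
Qed.

Lemma theta_tdec_truncation x k :
  (0 < k)%N -> theta k (tdec (truncation x k)) = theta k x.
Proof.
case: k => // k _; rewrite truncationE; set v := tdec _.
have e : mantissa v k.+1 = mantissa x k.+1 by rewrite mantissa_tdec.
by rewrite !thetaS e (mantissa_pred e).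
Qed.

Lemma sub_specE x y z : sub_spec x y z <-> value z = value x - value y.
Proof.
rewrite /sub_spec /=; pose D k := mantissa x k - mantissa y k.
have DE k : truncation x k - truncation y k = (D k)%:~R / 10 ^+ k.
  by rewrite !truncationE -mulrBl -rmorphB.
have D_bounds k : (D k)%:~R - 1 < 10 ^+ k * (value x - value y) < (D k)%:~R + 1.
  by have := value_bounds x k; have := value_bounds y k; rewrite rmorphB /=; lra.
have case1 m : (forall k, (m < k)%N ->
      theta k (tdec (truncation x k)) = theta k (tdec (truncation y k))) ->
    value (tdec (truncation x m - truncation y m)) = value x - value y.
  move=> t_eq; rewrite DE value_tdec.
  (* Equal digits cancel, so the differences D_k are only multiplied by 10. *)
have De k : D (m + k)%N = D m * 10 ^+ k.
    elim: k => [|k IHk]; first by rewrite addn0 mulr1.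
    have := t_eq (m + k).+1%N; rewrite !theta_tdec_truncation // ltnS leq_addr.
    rewrite addnS exprS mulrCA -IHk /D !mantissaS => ->; ring.
  apply: (@eq_pow10_close _ _ 1) => k; exists (m + k)%N; first exact: leq_addl.
  rewrite -[X in X * `|_|]ger0_norm ?(ltW (pow10_gt0 _)) // -normrM mulrBr.
  have -> : 10 ^+ (m + k) * ((D m)%:~R / 10 ^+ m) = (D (m + k)%N)%:~R :> R.
    by rewrite De rmorphM /= rmorphXn /= exprD; field; rewrite pow10_neq0.
  by rewrite ler_norml; have := D_bounds (m + k)%N; lra.
have case2 v k : value v = value x - value y -> (0 < k)%N ->
    theta k (tdec (truncation x k)) <> theta k (tdec (truncation y k)) ->
    mantissa v k.-1 = mantissa (tdec (truncation x k - truncation y k)) k.-1.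
  move=> ve k_gt0; rewrite !theta_tdec_truncation // DE.
  set u := tdec _; have uE : mantissa u k = D k by rewrite mantissa_tdec.
  have := value_bounds v k; rewrite ve; have := D_bounds k.
  move=> /andP[h1 h2] /andP[h3 h4].
  have : D k < mantissa v k + 2.
    by rewrite -(ltr_int R) (rmorphD _ (mantissa v k)) /=; lra.
  have : mantissa v k < D k + 1.
    by rewrite -(ltr_int R) (rmorphD _ (D k)) /=; lra.
  case: k k_gt0 u uE {h1 h2 h3 h4} => // k _ u uE.
  (* The mantissa of v is D or D - 1, and the last digit of D is not 0, so that
     subtracting 1 does not change the leading part. *)
  move: uE; rewrite [k.+1.-1]/= /D !mantissaS.
  have := thetaS_bounds x k; have := thetaS_bounds y k.
  by have := thetaS_bounds u k; have := thetaS_bounds v k; lia.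
set r := value x - value y in case1 case2 *.
split=> [[[m [t_eq ->]]|[k [k_inc t_neq ez]]]|zr]; first exact: case1.
  apply: (@eq_pow10_close _ _ 1) => n; exists (k n).-1.
    by have := increasing_positive_gt k_inc n; lia.
  have kn : (0 < k n)%N by have := increasing_positive_gt k_inc n; lia.
  move: (ez n) => /truncationP; rewrite -(case2 _ _ (decimal_ofK r) kn (t_neq n)) => e.
  rewrite -[X in X * `|_|]ger0_norm ?(ltW (pow10_gt0 _)) // -normrM mulrBr.
  have := value_bounds z (k n).-1; have := value_bounds (decimal_of r) (k n).-1.
  by rewrite decimal_ofK e ler_norml; lra.
pose t u k := theta k (tdec (truncation u k)).
have [[m t_eq]|h] := EM (exists m, forall k, (m < k)%N -> t x k = t y k).
  by left; exists m; split=> //; apply: value_inj; rewrite case1.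
right; have [k [k_inc t_neq]] : exists k, increasing_positive k /\
    forall i, t x (k i) <> t y (k i).
  apply: (@subsequenceP (fun k => t x k <> t y k)) => m.
  apply: contrapT => h'; apply: h; exists m => k mk.
  by apply: contrapT => t_neq; apply: h'; exists k.
exists k; split=> // i; apply/truncationP/case2 => //; last exact: t_neq.
by have := increasing_positive_gt k_inc i; lia.
Qed.

Lemma value_dzero : value dzero = 0.
Proof.
apply: value_unique => k; suff -> : mantissa dzero k = 0 by rewrite mulr0; lra.
by elim: k => //= k ->.
Qed.

Lemma value_dopp x : value (dopp x) = - value x.
Proof.
rewrite -[RHS]sub0r -value_dzero.
apply/sub_specE/(@xgetPex _ dzero [set z | sub_spec dzero x z]).
by exists (decimal_of (value dzero - value x)); apply/sub_specE; rewrite decimal_ofK.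
Qed.

(** * Multiplication *)

Lemma value_tdec_pow10 s : value (tdec (10 ^+ s)) = 10 ^+ s.
Proof. by have := value_tdec (10 ^+ s) 0; rewrite !expr0 !divr1 !rmorphXn. Qed.

Lemma mantissa_ge0 x k : 0 <= value x -> 0 <= mantissa x k.
Proof.
move=> x_ge0; have /andP[_] := value_bounds x k.
move/(le_lt_trans (mulr_ge0 (ltW (pow10_gt0 k)) x_ge0)).
by rewrite -(intrD _ _ 1) (ltr_int R 0); lia.
Qed.

(** With s extra places, where x + y <= 10^s, the product of the truncations is
    within 10^-k of the product:
    x y - x_(k+s) y_(k+s) <= (x + y) 10^-(k+s) <= 10^-k. *)
Lemma mul_carry_specE x y z s :
  0 <= value x -> 0 <= value y -> value x + value y <= 10 ^+ s ->
  carry_spec (fun k => tdec (truncation x (k + s) * truncation y (k + s))) z <->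
  value z = value x * value y.
Proof.
move=> x_ge0 y_ge0 le_s; set w := fun k => _.
have wE k : value (w k) = (mantissa x (k + s) * mantissa y (k + s))%:~R /
    10 ^+ (k + s + (k + s)).
  rewrite /w !truncationE -value_tdec; congr (value (tdec _)).
  by rewrite mulf_div -exprD -rmorphM.
have w_le k : value (w k) <= value x * value y.
  rewrite wE ler_pdivrMr ?pow10_gt0 // rmorphM (exprD _ (k + s)) mulrACA /=.
  rewrite ![value _ * _]mulrC ler_pM ?ler0z ?mantissa_ge0 //.
    by have /andP[] := value_bounds x (k + s).
  by have /andP[] := value_bounds y (k + s).
have w_close k : 10 ^+ k * (value x * value y) <= 10 ^+ k * value (w k) + 1.
  have N0 := pow10_gt0 (k + s); rewrite wE (exprD _ (k + s)) rmorphM /=.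
  have /andP[hx1 hx2] := value_bounds x (k + s).
  have /andP[hy1 hy2] := value_bounds y (k + s).
  have X0 : 0 <= (mantissa x (k + s))%:~R :> R by rewrite ler0z mantissa_ge0.
  have Y0 : 0 <= (mantissa y (k + s))%:~R :> R by rewrite ler0z mantissa_ge0.
  have NE : 10 ^+ (k + s) = 10 ^+ k * 10 ^+ s :> R by rewrite exprD.
  move: hx1 hx2 hy1 hy2 X0 Y0 N0 NE (pow10_gt0 k).
  move: le_s; set S := 10 ^+ s; set K := 10 ^+ k; set N := 10 ^+ (k + s).
  set X := _%:~R; set Y := _%:~R; set a := value x; set b := value y.
  move=> le_s hx1 hx2 hy1 hy2 X0 Y0 N0 NE K0.
  (* With N = K S, the claim is N a N b - X Y <= N S, and the left-hand side is
     N a (N b - Y) + Y (N a - X) <= N a + Y <= N (a + b). *)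
  rewrite -subr_ge0.
  have -> : K * (X * Y / (N * N)) + 1 - K * (a * b) =
      K * (N * S - (N * a * (N * b) - X * Y)) / (N * N).
    have S0 : S != 0 by exact: pow10_neq0.
    by rewrite NE; field; rewrite S0 gt_eqF.
  rewrite divr_ge0 ?mulr_ge0 ?(ltW N0) ?(ltW K0) // subr_ge0.
  have h1 : N * a * (N * b - Y) <= N * a * 1.
    by apply: ler_wpM2l; [rewrite mulr_ge0 ?(ltW N0) | lra].
  have h2 : Y * (N * a - X) <= Y * 1 by apply: ler_wpM2l => //; lra.
  have h3 : N * (a + b) <= N * S by rewrite ler_pM2l.
  by lra.
have w_mono k : value (w k) <= value (w k.+1).
  rewrite !wE ler_pdivrMr ?pow10_gt0 // mulrAC ler_pdivlMr ?pow10_gt0 //.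
  have le10 u n : 10 * (mantissa u n)%:~R <= (mantissa u n.+1)%:~R :> R.
    rewrite -[10]/(10%:~R) -intrM ler_int mantissaS.
    by have := thetaS_bounds u n; lia.
  rewrite !addSn addnS !exprS !intrM.
  rewrite (_ : forall P Q : R, P * (10 * (10 * Q)) = 10 * 10 * P * Q); last by move=> *; ring.
  rewrite ler_pM2r ?pow10_gt0 // mulrACA.
  by rewrite ler_pM ?mulr_ge0 ?ler0z ?mantissa_ge0.
apply: (@carry_spec_value w) => k.
- have /andP[h _] := value_bounds (w k) k; apply: le_trans h _.
  by rewrite ler_pM2l ?pow10_gt0.
- by have := value_bounds (w k) k; have := w_close k; lra.
- suff : 10 * mantissa (w k) k < mantissa (w k.+1) k.+1 + 1 by lia.
  have := value_bounds (w k) k; have := value_bounds (w k.+1) k.+1.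
  have : 10 ^+ k * value (w k) <= 10 ^+ k * value (w k.+1) by rewrite ler_pM2l ?pow10_gt0.
  by rewrite -(ltr_int R) rmorphD rmorphM /= exprS; lra.
Qed.

Lemma nonneg_mul_specE x y z : 0 <= value x -> 0 <= value y ->
  nonneg_mul_spec x y z <-> value z = value x * value y.
Proof.
move=> x_ge0 y_ge0; split=> [[s [/dle_value le_s hz]]|zE].
  rewrite value_dadd value_tdec_pow10 in le_s.
  exact/(mul_carry_specE z x_ge0 y_ge0 le_s).
have [s /ltW le_s] := pow10_unbounded (value x + value y).
exists s; split; last exact/mul_carry_specE.
by apply/dle_value; rewrite value_dadd value_tdec_pow10.
Qed.

Lemma value_nonneg_mul x y : 0 <= value x -> 0 <= value y ->
  value (nonneg_mul x y) = value x * value y.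
Proof.
move=> x_ge0 y_ge0.
apply/(nonneg_mul_specE _ x_ge0 y_ge0).
apply: (@xgetPex _ dzero [set z | nonneg_mul_spec x y z]).
by exists (decimal_of (value x * value y)); apply/nonneg_mul_specE; rewrite ?decimal_ofK.
Qed.

Lemma value_dmul x y : value (dmul x y) = value x * value y.
Proof.
rewrite /dmul !ipart_ge0.
case: (leP 0 (value x)) => [x_ge0|/ltW x_le0];
  case: (leP 0 (value y)) => [y_ge0|/ltW y_le0];
  by rewrite ?value_dopp value_nonneg_mul ?value_dopp ?oppr_ge0 // ?mulrNN ?mulrN ?mulNr ?opprK.
Qed.

End Value.

(** * The field structure *)

(** Any complete ordered field would do. *)
Local Notation R := Rdefinitions.R.
(* From here on only [value_dadd] and [value_dmul] matter. Rewriting with them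
   would otherwise compare distinct products by unfolding them. *)
Opaque dadd dmul.

Definition dinv (x : decimal) : decimal := decimal_of (value R x)^-1.
Definition decimal1 : decimal := decimal_of (1 : R).

Lemma daddA : associative dadd.
Proof. by move=> x y z; apply: (@value_inj R); rewrite !value_dadd addrA. Qed.

Lemma daddC : commutative dadd.
Proof. by move=> x y; apply: (@value_inj R); rewrite !value_dadd addrC. Qed.

Lemma dadd0d : left_id dzero dadd.
Proof. by move=> x; apply: (@value_inj R); rewrite value_dadd value_dzero add0r. Qed.

Lemma daddNd : left_inverse dzero dopp dadd.
Proof.
by move=> x; apply: (@value_inj R); rewrite value_dadd value_dopp value_dzero addNr.
Qed.

HB.instance Definition _ :=
  GRing.isZmodule.Build decimal daddA daddC dadd0d daddNd.

Lemma dmulA : associative dmul.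
Proof. by move=> x y z; apply: (@value_inj R); rewrite !value_dmul mulrA. Qed.

Lemma dmulC : commutative dmul.
Proof. by move=> x y; apply: (@value_inj R); rewrite !value_dmul mulrC. Qed.

Lemma dmul1d : left_id decimal1 dmul.
Proof. by move=> x; apply: (@value_inj R); rewrite value_dmul decimal_ofK mul1r. Qed.

Lemma dmulDl : left_distributive dmul dadd.
Proof.
by move=> x y z; apply: (@value_inj R); rewrite !(value_dmul, value_dadd) mulrDl.
Qed.

Lemma decimal1_neq0 : decimal1 != dzero.
Proof.
apply/eqP => /(congr1 (value R)); rewrite decimal_ofK value_dzero.
exact/eqP/oner_neq0.
Qed.

HB.instance Definition _ :=
  GRing.Zmodule_isComNzRing.Build decimal dmulA dmulC dmul1d dmulDl decimal1_neq0.

Lemma dmulVd (x : decimal) : x != 0 -> dinv x * x = 1.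
Proof.
move=> x0; apply: (@value_inj R); rewrite [LHS]value_dmul !decimal_ofK mulVf //.
by apply: contra_neq x0 => x0; apply: (@value_inj R); rewrite x0 value_dzero.
Qed.

Lemma dinv0 : dinv 0 = 0.
Proof. by apply: (@value_inj R); rewrite decimal_ofK value_dzero invr0. Qed.

HB.instance Definition _ := GRing.ComNzRing_isField.Build decimal dmulVd dinv0.

Theorem mainTheorem1 : is_field dadd dmul.
Proof. by exists (GRing.Field.class decimal). Qed.
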